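(* Let $f:[a;b]\to\mathbb{R}$ be a càdlàg function and $c>0$. For any $s\in(a;b]$ the following equalities hold: $$UTV^c(f,[a;s])=f_U^c(s),\qquad DTV^c(f,[a;s])=f_D^c(s),\qquad TV^c(f,[a;s])=f_U^c(s)+f_D^c(s),$$ where $f_U^c,f_D^c$ are the functions constructed from $f$ and $c$ in the context.
   Context: Let $-\infty<a<b<+\infty$. For $a<s\le b$, suprema being over $n\ge1$ and $a\le t_0<\dots<t_n\le s$: $TV^c(f,[a;s])=\sup\sum_{i=1}^n\max\{|f(t_i)-f(t_{i-1})|-c,0\}$, $UTV^c(f,[a;s])=\sup\sum_{i=1}^n\max\{f(t_i)-f(t_{i-1})-c,0\}$, $DTV^c(f,[a;s])=\sup\sum_{i=1}^n\max\{f(t_{i-1})-f(t_i)-c,0\}$. Construction of $f_U^c,f_D^c:[a;b]\to[0;+\infty)$ (with $\inf\emptyset=\infty$). Let $T_D^cf=\inf\{s\in[a;b]:\sup_{t\in[a;s]}f(t)-f(s)\ge c\}$ and $T_U^cf=\inf\{s\in[a;b]:f(s)-\inf_{t\in[a;s]}f(t)\ge c\}$. Case $T_D^cf\ge T_U^cf$ (including both infinite). Put $T_{D,-1}^c=a$, $T_{U,0}^c=T_U^cf$ and for $k=0,1,2,\dots$: $T_{D,k}^c=\inf\{s\in[T_{U,k}^c;b]:\sup_{t\in[T_{U,k}^c;s]}f(t)-f(s)\ge c\}$ if $T_{U,k}^c<b$, and $T_{D,k}^c=\infty$ if $T_{U,k}^c\ge b$; $T_{U,k+1}^c=\inf\{s\in[T_{D,k}^c;b]:f(s)-\inf_{t\in[T_{D,k}^c;s]}f(t)\ge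 c\}$ if $T_{D,k}^c<b$, and $T_{U,k+1}^c=\infty$ if $T_{D,k}^c\ge b$. (Only finitely many of these times are finite.) For $k$ with $T_{D,k-1}^c<\infty$ put $m_k^c(s)=\inf_{t\in[T_{D,k-1}^c;s]}f(t)$ for $s\in[T_{D,k-1}^c;T_{U,k}^c)\cap[a;b]$ and $m_k^c=\inf_{t\in[T_{D,k-1}^c;T_{U,k}^c)\cap[a;b]}f(t)$; for $k$ with $T_{U,k}^c<\infty$ put $M_k^c(s)=\sup_{t\in[T_{U,k}^c;s]}f(t)$ for $s\in[T_{U,k}^c;T_{D,k}^c)\cap[a;b]$ and $M_k^c=\sup_{t\in[T_{U,k}^c;T_{D,k}^c)\cap[a;b]}f(t)$. Define $f_U^c(s)=f_D^c(s)=0$ for $s\in[a;T_{U,0}^c)\cap[a;b]$; for $s\in[T_{U,k}^c;T_{D,k}^c)\cap[a;b]$: $f_U^c(s)=\sum_{i=0}^{k-1}(M_i^c-m_i^c-c)+M_k^c(s)-m_k^c-c$ and $f_D^c(s)=\sum_{i=0}^{k-1}(M_i^c-m_{i+1}^c-c)$; for $s\in[T_{D,k}^c;T_{U,k+1}^c)\cap[a;b]$: $f_U^c(s)=\sum_{i=0}^{k}(M_i^c-m_i^c-c)$ and $f_D^c(s)=\sum_{i=0}^{k-1}(M_i^c-m_{i+1}^c-c)+M_k^c-m_{k+1}^c(s)-c$ ($k=0,1,2,\dots$). Case $T_D^cf<T_U^cf$. Put $S_{U,-1}^c=a$, $S_{D,0}^c=T_D^cf$ and for $k=0,1,2,\dots$: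 $S_{U,k}^c=\inf\{s\in[S_{D,k}^c;b]:f(s)-\inf_{t\in[S_{D,k}^c;s]}f(t)\ge c\}$ if $S_{D,k}^c<b$, and $S_{U,k}^c=\infty$ if $S_{D,k}^c\ge b$; $S_{D,k+1}^c=\inf\{s\in[S_{U,k}^c;b]:\sup_{t\in[S_{U,k}^c;s]}f(t)-f(s)\ge c\}$ if $S_{U,k}^c<b$, and $S_{D,k+1}^c=\infty$ if $S_{U,k}^c\ge b$. (Only finitely many of these times are finite.) For $k$ with $S_{U,k-1}^c<\infty$ put $N_k^c(s)=\sup_{t\in[S_{U,k-1}^c;s]}f(t)$ for $s\in[S_{U,k-1}^c;S_{D,k}^c)\cap[a;b]$ and $N_k^c=\sup_{t\in[S_{U,k-1}^c;S_{D,k}^c)\cap[a;b]}f(t)$; for $k$ with $S_{D,k}^c<\infty$ put $n_k^c(s)=\inf_{t\in[S_{D,k}^c;s]}f(t)$ for $s\in[S_{D,k}^c;S_{U,k}^c)\cap[a;b]$ and $n_k^c=\inf_{t\in[S_{D,k}^c;S_{U,k}^c)\cap[a;b]}f(t)$. Define $f_U^c(s)=f_D^c(s)=0$ for $s\in[a;S_{D,0}^c)\cap[a;b]$; for $s\in[S_{D,k}^c;S_{U,k}^c)\cap[a;b]$: $f_D^c(s)=\sum_{i=0}^{k-1}(N_i^c-n_i^c-c)+N_k^c-n_k^c(s)-c$ and $f_U^c(s)=\sum_{i=0}^{k-1}(N_{i+1}^c-n_i^c-c)$; for $s\in[S_{U,k}^c;S_{D,k+1}^c)\cap[a;b]$: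 $f_D^c(s)=\sum_{i=0}^{k}(N_i^c-n_i^c-c)$ and $f_U^c(s)=\sum_{i=0}^{k-1}(N_{i+1}^c-n_i^c-c)+N_{k+1}^c(s)-n_k^c-c$ ($k=0,1,2,\dots$). (Equivalently, $f_U^c=(-f)_D^c$ and $f_D^c=(-f)_U^c$.) *)

(* Defs.v *)
From mathcomp Require Import all_boot all_order all_algebra.
From mathcomp Require Import all_classical all_reals all_analysis.
Set Implicit Arguments.
Unset Strict Implicit.
Unset Printing Implicit Defensive.
Import Order.TTheory GRing.Theory Num.Theory.
Import numFieldNormedType.Exports.
Local Open Scope classical_set_scope.
Local Open Scope ring_scope.

(* A function on [a; b] is represented by a total function R -> R of which
   only the values on [a; b] are ever used. *)
Definition cadlag {R : realType} (a b : R) (f : R -> R) : Prop :=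
  (forall t, a <= t < b -> f x @[x --> t^'+] --> f t) /\
  (forall t, a < t <= b -> cvg (f x @[x --> t^'-])).

Section truncated_variation.
Context {R : realType}.
Implicit Types (f : R -> R) (a s c : R).

Definition subdivision a s (n : nat) (t : nat -> R) : Prop :=
  [/\ (1 <= n)%N, a <= t 0%N, forall i, (i < n)%N -> t i < t i.+1 & t n <= s].

Definition TV f c a s : \bar R :=
  ereal_sup [set x | exists n t, subdivision a s n t /\
    x = (\sum_(1 <= i < n.+1) Num.max (`|f (t i) - f (t i.-1)| - c) 0)%:E].

Definition UTV f c a s : \bar R :=
  ereal_sup [set x | exists n t, subdivision a s n t /\
    x = (\sum_(1 <= i < n.+1) Num.max (f (t i) - f (t i.-1) - c) 0)%:E].

Definition DTV f c a s : \bar R :=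
  ereal_sup [set x | exists n t, subdivision a s n t /\
    x = (\sum_(1 <= i < n.+1) Num.max (f (t i.-1) - f (t i) - c) 0)%:E].

End truncated_variation.

Section construction.
Context {R : realType}.
Variables (f : R -> R) (a b c : R).

(* The times live in \bar R, where ereal_inf set0 = +oo. *)

(* [t; s] *)
Definition itvcc (t : \bar R) (s : R) : set R :=
  [set u | (t <= u%:E)%E /\ u <= s].

(* [t; t') `&` [a; b] *)
Definition itvco (t t' : \bar R) : set R :=
  [set u | (t <= u%:E < t')%E /\ a <= u <= b].

(* sup and inf are the real-valued ones: they are applied only to nonempty
   subsets of f @` [a; b], which are bounded when f is cadlag. *)
Definition sup_on (A : set R) : R := sup (f @` A).
Definition inf_on (A : set R) : R := inf (f @` A).

Definition drop_time (t : \bar R) : \bar R :=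
  ereal_inf (EFin @` [set s | itvcc t b s /\ c <= sup_on (itvcc t s) - f s]).

Definition rise_time (t : \bar R) : \bar R :=
  ereal_inf (EFin @` [set s | itvcc t b s /\ c <= f s - inf_on (itvcc t s)]).

Definition next_drop (t : \bar R) : \bar R :=
  if (t < b%:E)%E then drop_time t else +oo%E.

Definition next_rise (t : \bar R) : \bar R :=
  if (t < b%:E)%E then rise_time t else +oo%E.

Definition first_drop : \bar R := drop_time a%:E.
Definition first_rise : \bar R := rise_time a%:E.

(* Case first_rise <= first_drop. *)

Fixpoint T_U (k : nat) : \bar R :=
  if k is j.+1 then next_rise (next_drop (T_U j)) else first_rise.

Definition T_D (k : nat) : \bar R := next_drop (T_U k).

(* T_D_pred k is T_D (k - 1), with the convention T_D (-1) = a. *)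
Definition T_D_pred (k : nat) : \bar R := if k is j.+1 then T_D j else a%:E.

Definition m_at (k : nat) (s : R) : R := inf_on (itvcc (T_D_pred k) s).
Definition m_ (k : nat) : R := inf_on (itvco (T_D_pred k) (T_U k)).
Definition M_at (k : nat) (s : R) : R := sup_on (itvcc (T_U k) s).
Definition M_ (k : nat) : R := sup_on (itvco (T_U k) (T_D k)).

(* For s in [T_U 0; b], the unique k such that s lies in [T_U k; T_D k) or in
   [T_D k; T_U k.+1). *)
Definition T_index (s : R) : nat :=
  xget 0%N [set k | (T_U k <= s%:E < T_D k)%E \/ (T_D k <= s%:E < T_U k.+1)%E].

Definition rise_f_U (s : R) : R :=
  let k := T_index s in
  if (s%:E < T_U 0)%E then 0
  else if (s%:E < T_D k)%E then
    \sum_(i < k) (M_ i - m_ i - c) + (M_at k s - m_ k - c)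
  else \sum_(i < k.+1) (M_ i - m_ i - c).

Definition rise_f_D (s : R) : R :=
  let k := T_index s in
  if (s%:E < T_U 0)%E then 0
  else if (s%:E < T_D k)%E then
    \sum_(i < k) (M_ i - m_ i.+1 - c)
  else \sum_(i < k) (M_ i - m_ i.+1 - c) + (M_ k - m_at k.+1 s - c).

(* Case first_drop < first_rise. *)

Fixpoint S_D (k : nat) : \bar R :=
  if k is j.+1 then next_drop (next_rise (S_D j)) else first_drop.

Definition S_U (k : nat) : \bar R := next_rise (S_D k).

(* S_U_pred k is S_U (k - 1), with the convention S_U (-1) = a. *)
Definition S_U_pred (k : nat) : \bar R := if k is j.+1 then S_U j else a%:E.

Definition N_at (k : nat) (s : R) : R := sup_on (itvcc (S_U_pred k) s).
Definition N_ (k : nat) : R := sup_on (itvco (S_U_pred k) (S_D k)).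
Definition n_at (k : nat) (s : R) : R := inf_on (itvcc (S_D k) s).
Definition n_ (k : nat) : R := inf_on (itvco (S_D k) (S_U k)).

(* For s in [S_D 0; b], the unique k such that s lies in [S_D k; S_U k) or in
   [S_U k; S_D k.+1). *)
Definition S_index (s : R) : nat :=
  xget 0%N [set k | (S_D k <= s%:E < S_U k)%E \/ (S_U k <= s%:E < S_D k.+1)%E].

Definition drop_f_D (s : R) : R :=
  let k := S_index s in
  if (s%:E < S_D 0)%E then 0
  else if (s%:E < S_U k)%E then
    \sum_(i < k) (N_ i - n_ i - c) + (N_ k - n_at k s - c)
  else \sum_(i < k.+1) (N_ i - n_ i - c).

Definition drop_f_U (s : R) : R :=
  let k := S_index s in
  if (s%:E < S_D 0)%E then 0
  else if (s%:E < S_U k)%E then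
    \sum_(i < k) (N_ i.+1 - n_ i - c)
  else \sum_(i < k) (N_ i.+1 - n_ i - c) + (N_at k.+1 s - n_ k - c).

Definition f_U (s : R) : R :=
  if (first_rise <= first_drop)%E then rise_f_U s else drop_f_U s.

Definition f_D (s : R) : R :=
  if (first_rise <= first_drop)%E then rise_f_D s else drop_f_D s.

End construction.

(* Main.v *)
Require Import Defs.
From mathcomp Require Import all_boot all_order all_algebra.
From mathcomp Require Import all_classical all_reals all_analysis.
From mathcomp Require Import lra zify.
Import Order.TTheory GRing.Theory Num.Theory.
Import numFieldNormedType.Exports.
Local Open Scope classical_set_scope.
Local Open Scope ring_scope.

(** The process alternates between waiting for a drop of size [c] and waiting
    for a rise of size [c].  Cut [[a; b]] at the successive times; on the [j]-th
    piece let [g_j] be [f] or [- f], alternately, the sign being such that the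
    piece ends as soon as [g_j] is [c] below its running supremum, and let
    [E_j] be the supremum of [g_j] on that piece.  Writing minima of [f] as
    maxima of [- f] turns both constructions (starting with a rise or with a
    drop) into one: in either of them the functions [f_U] and [f_D] add up the
    terms [E_j + E_(j-1) - c], [j >= 1], where [f_U] collects those with
    [g_j = f] and [f_D] those with [g_j = - f], and where on the current piece
    [E_j] is replaced by the running supremum.  Below, [gain true] and
    [gain false] are these two sums.

    Upper bounds.  The end of piece [j - 1] is attained, so the next piece
    starts at a point where [g_j >= c - E_(j-1)]; hence all terms are
    nonnegative and both gains are nondecreasing and nonnegative
    ([gain_homo], [gain_ge0]).  In the difference of the gains the sums
    telescope, and [f - (gain true - gain false)] is seen to stay in a band of
    width [c] ([gap_band]).  For [u <= v] this yields
    [f v - f u - c <= gain true v - gain true u], because [gain false] is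
    nondecreasing, and symmetrically for decrements ([increment_le_gain]).
    Summing over a subdivision gives [UTV <= gain true] and
    [DTV <= gain false].

    Lower bounds.  Choosing one point almost realizing [E_j] in each piece
    produces a subdivision whose sum for [TV] is almost
    [gain true + gain false] ([chain_in_pieces]).  As every [TV] sum is at most
    the corresponding [UTV] sum plus the corresponding [DTV] sum, this single
    estimate forces equality everywhere ([variations_eq]).

    Left limits make the number of pieces finite, hence every point of [[a; b]]
    lies in one of them ([piece_exists]): infinitely many cuts would accumulate
    at a point on whose left [f] keeps oscillating by at least [c]. *)

(** * Bounds and suprema *)

Section cadlag_functions.
Set Implicit Arguments.
Unset Strict Implicit.
Context {R : realType}.
Implicit Types (a b c t : R) (f g : R -> R) (A : set R).

(** One-sided limits bound [f] near each point; compactness does the rest. *)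
Lemma cadlag_bounded a b f : cadlag a b f ->
  exists K, forall x, a <= x <= b -> `|f x| <= K.
Proof.
move=> [fr fl].
have /compact_near_coveringP cov := @segment_compact R a b.
have [] := cov R (pinfty_nbhs R)
  (fun K x => a <= x <= b -> `|f x| <= K) _ _.
  move=> x; rewrite /= in_itv /= => xab.
  have [dr [dr0 [Kr Hr]]] : exists d, 0 < d /\ exists K,
      forall y, a <= y <= b -> x < y < x + d -> `|f y| <= K.
    have [xb|bx] := ltP x b; last first.
      by exists 1; split => //; exists 0 => y; lra.
    have /cvgrPdist_lt /(_ 1 ltr01) : f y @[y --> x^'+] --> f x by apply: fr; lra.
    move=> [d /= d0 H]; exists d; split => //; exists (`|f x| + 1) => y _ xy.
    have Hy : `|f x - f y| < 1 by apply: H; rewrite /= ?ltr_distl; lra.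
    by rewrite -[f y](subrK (f x)) addrC (le_trans (ler_normD _ _)) // lerD2l distrC ltW.
  have [dl [dl0 [Kl Hl]]] : exists d, 0 < d /\ exists K,
      forall y, a <= y <= b -> x - d < y < x -> `|f y| <= K.
    have [ax|xa] := ltP a x; last first.
      by exists 1; split => //; exists 0 => y; lra.
    have /cvg_ex [l /cvgrPdist_lt /(_ 1 ltr01)] : cvg (f y @[y --> x^'-]) by apply: fl; lra.
    move=> [d /= d0 H]; exists d; split => //; exists (`|l| + 1) => y _ xy.
    have Hy : `|l - f y| < 1 by apply: H; rewrite /= ?ltr_distl; lra.
    by rewrite -[f y](subrK l) addrC (le_trans (ler_normD _ _)) // lerD2l distrC ltW.
  pose d := Num.min dl dr; pose K := Num.max `|f x| (Num.max Kl Kr).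
  exists (ball x d, [set M | K < M]) => /=.
    split; first by apply: nbhsx_ballx; rewrite /d lt_min dl0 dr0.
    by exists K; split => //; rewrite num_real.
  move=> [y M] /= [xy KM] yab; apply: ltW; apply: le_lt_trans KM.
  move: xy; rewrite /ball /= ltr_distl /d => xy.
  have : d <= dl /\ d <= dr by rewrite /d !ge_min !lexx orbT.
  rewrite /d => -[d1 d2].
  rewrite /K !le_max; have [yx|yx|->] := ltgtP y x; last by rewrite lexx.
    by rewrite Hl ?orbT //; lra.
  by rewrite Hr ?orbT //; lra.
move=> K [_ H]; exists (K + 1) => x xab.
by apply: (H (K + 1)); rewrite /= ?ltrDl ?in_itv.
Qed.

(** A rise of [f] is a drop of [- f] and an infimum of [f] is minus a supremum of
    [- f], so that drops and suprema of [signed e f] cover all cases. *)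
Definition signed (e : bool) (f : R -> R) (x : R) : R := if e then f x else - f x.

Lemma signedN e f x : signed (~~ e) f x = - signed e f x.
Proof. by case: e; rewrite /= ?opprK. Qed.

Lemma inf_onE f A : inf_on f A = - sup_on (signed false f) A.
Proof. by rewrite /inf_on /sup_on /inf image_comp. Qed.

Lemma signed_right_cont e a b f : cadlag a b f ->
  forall t, a <= t < b -> signed e f x @[x --> t^'+] --> signed e f t.
Proof.
by move=> [fr _] t /fr; case: e => //= ft; apply: cvgN.
Qed.

Lemma le_sup_on g a b A x : has_ubound (g @` `[a, b]) -> A `<=` `[a, b] ->
  A x -> g x <= sup_on g A.
Proof.
move=> [K gK] Aab Ax; apply: ub_le_sup; last by exists x.
by exists K => _ [y /Aab yab <-]; apply: gK; exists y.
Qed.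

Lemma sup_on_le g A y : A !=set0 -> (forall x, A x -> g x <= y) -> sup_on g A <= y.
Proof.
move=> [x Ax] Ay; apply: ge_sup; first by exists (g x), x.
by move=> _ [z /Ay ? <-].
Qed.

Lemma sup_on_adherent g a b A e : has_ubound (g @` `[a, b]) -> A `<=` `[a, b] ->
  A !=set0 -> 0 < e -> exists2 x, A x & sup_on g A - e < g x.
Proof.
move=> [K gK] Aab [x Ax] e0; have [|_ [y Ay <-] ?] := @sup_adherent R (g @` A) _ e0.
  split; first by exists (g x), x.
  by exists K => _ [y /Aab yab <-]; apply: gK; exists y.
by exists y.
Qed.

Lemma signed_has_ubound e a b f : cadlag a b f -> has_ubound (signed e f @` `[a, b]).
Proof.
move=> /cadlag_bounded[K fK]; exists K => _ [x /= xab <-].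
move: xab; rewrite in_itv /= => /fK; rewrite ler_norml /signed.
by case: e; lra.
Qed.

(** * The first drop of size [c] *)

Section drop_time.
Variables (a b c : R) (g : R -> R).
Hypotheses (c0 : 0 < c) (g_bnd : has_ubound (g @` `[a, b])).
Hypothesis g_cont : forall t, a <= t < b -> g x @[x --> t^'+] --> g t.
Implicit Types (T : \bar R) (u v : R).

Lemma itvcc_sub T u : (a%:E <= T)%E -> u <= b -> itvcc T u `<=` `[a, b].
Proof.
move=> aT ub x [Tx xu]; rewrite /= in_itv /=; apply/andP; split; last exact: le_trans xu ub.
by have := le_trans aT Tx; rewrite lee_fin.
Qed.

Lemma itvco_sub T T' : itvco a b T T' `<=` `[a, b].
Proof. by move=> x [_ xab]; rewrite /= in_itv. Qed.

Lemma le_drop_time T : (T <= drop_time g b c T)%E.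
Proof. by apply: le_ereal_inf_tmp => _ [u [[Tu _] _] <-]. Qed.

(** From [b] on there is no room for a positive drop: the infimum is then taken
    over the empty set. *)
Lemma next_dropE T : next_drop g b c T = drop_time g b c T.
Proof.
rewrite /next_drop; case: ltP => // bT; apply/esym/eqP.
rewrite -leye_eq; apply: le_ereal_inf_tmp => _ [u [[Tu ub] cu] <-].
exfalso; suff us : itvcc T u = [set u].
  by move: cu; rewrite us /sup_on image_set1 sup1 subrr leNgt c0.
apply/seteqP; split => [x [Tx xu]|x ->]; last by split.
have := le_trans bT Tx; rewrite lee_fin /= => bx.
by apply/eqP; rewrite eq_le xu (le_trans ub bx).
Qed.

Lemma lt_drop_time T u : (T <= u%:E)%E -> u <= b -> (u%:E < drop_time g b c T)%E ->
  sup_on g (itvcc T u) - g u < c.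
Proof.
move=> Tu ub; apply: contraTlt => cu; rewrite -leNgt.
by apply: ereal_inf_lbound; exists u.
Qed.

(** The infimum defining [drop_time] is attained, because [g] and its running
    supremum are right-continuous; and the point itself does not contribute to
    the supremum, because [0 < c]. *)
Lemma drop_time_attained T : (a%:E <= T)%E -> (drop_time g b c T <= b%:E)%E ->
  exists y, [/\ drop_time g b c T = y%:E, (T < y%:E)%E, y <= b &
    c <= sup_on g (itvco a b T y%:E) - g y].
Proof.
move=> aT; set D := drop_time g b c T => Db.
have TD : (T <= D)%E by exact: le_drop_time.
have [y Dy] : exists y, D = y%:E.
  case: D Db TD => [y|//|] _ TD; first by exists y.
  by have := le_trans aT TD.
rewrite Dy lee_fin in Db TD *.
have ay : a <= y by rewrite -lee_fin (le_trans aT).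
have lb u : (T <= u%:E)%E -> u <= b -> c <= sup_on g (itvcc T u) - g u -> y <= u.
  by move=> Tu ub cu; rewrite -lee_fin -Dy; apply: ereal_inf_lbound; exists u.
have near_y d : 0 < d -> exists u, [/\ y <= u, u < y + d, u <= b &
    c <= sup_on g (itvcc T u) - g u].
  move=> d0; have : (D < (y + d)%:E)%E by rewrite Dy lte_fin ltrDl.
  move=> /ereal_inf_lt[_ [u [[Tu ub] cu] <-]]; rewrite lte_fin => uyd.
  by exists u; split => //; apply: lb.
have cy : c <= sup_on g (itvcc T y) - g y.
  rewrite leNgt; apply/negP => yc.
  have [yb|yb] := ltP y b; last first.
    have [u [yu _ ub cu]] := near_y 1 ltr01.
    have uy : u = y by lra.
    by move: cu; rewrite uy leNgt yc.
  (* [g] varies by less than [e] just after [y], which moves the drop by less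
     than [2 * e], that is, not up to [c] *)
  pose e := (c - (sup_on g (itvcc T y) - g y)) / 2.
  have e0 : 0 < e by rewrite /e; lra.
  have /cvgrPdist_lt /(_ e e0) [d /= d0 H] := g_cont (introT andP (conj ay yb)).
  have [u [yu uyd ub cu]] := near_y d d0.
  have He v : y <= v -> v <= u -> `|g y - g v| < e.
    rewrite le_eqVlt => /orP[/eqP <-|yv] vu; first by rewrite subrr normr0.
    by apply: H; rewrite /= ?ltr_distl; lra.
  have : sup_on g (itvcc T u) <= sup_on g (itvcc T y) + e.
    apply: sup_on_le => [|v [Tv vu]].
      by exists u; split => //; rewrite (le_trans TD).
    have [yv|vy] := leP y v.
      have := He v yv vu; rewrite ltr_distl => /andP[h1 h2].
      have : g y <= sup_on g (itvcc T y).
        by apply: (le_sup_on g_bnd (itvcc_sub aT Db)); split.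
      by lra.
    have : g v <= sup_on g (itvcc T y).
      by apply: (le_sup_on g_bnd (itvcc_sub aT Db)); split => //; lra.
    by lra.
  have := He u yu (lexx _); rewrite ltr_distl /e => ?.
  by lra.
(* points where [g] exceeds [g y] nearly reach the supremum, and they differ
   from [y] *)
have adh e : 0 < e -> e <= c ->
    exists2 v, itvco a b T y%:E v & sup_on g (itvcc T y) - e < g v.
  move=> e0 ec.
  have [|v [Tv vy] gv] := sup_on_adherent g_bnd (itvcc_sub aT Db) _ e0.
    by exists y; split.
  exists v => //; split; last first.
    by rewrite (le_trans vy Db) andbT -lee_fin (le_trans aT).
  rewrite Tv lte_fin lt_neqAle vy andbT; apply: contraTneq isT => vey.
  by move: gv; rewrite vey; lra.
exists y; split => //.
  by have [v [/andP[Tv vy] _] _] := adh c c0 (lexx _); exact: le_lt_trans vy.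
suff : sup_on g (itvcc T y) <= sup_on g (itvco a b T y%:E) by lra.
apply/ler_addgt0Pr => e e0.
have [||v vin gv] := adh (Num.min e c); rewrite ?lt_min ?ge_min ?e0 ?c0 ?lexx ?orbT //.
have := le_sup_on g_bnd (@itvco_sub _ _) vin.
have : Num.min e c <= e by rewrite ge_min lexx.
by lra.
Qed.

End drop_time.

(** * The alternating times *)

Section alternation.
Variables (a b c : R) (f : R -> R) (beta : bool).

(** The sign of [f] on piece [j].  Piece [0] is the initial one, on which both
    gains vanish; [beta] is [false] when the process starts by waiting for a
    rise of [f] and [true] when it starts by waiting for a drop. *)
Definition dir (j : nat) : bool := beta (+) odd j.

Fixpoint switch (j : nat) : \bar R :=
  if j is i.+1 then drop_time (signed (dir i) f) b c (switch i) else a%:E.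

Definition piece (j : nat) : set R := itvco a b (switch j) (switch j.+1).

Definition top (j : nat) : R := sup_on (signed (dir j) f) (piece j).

Definition top_at (j : nat) (s : R) : R :=
  sup_on (signed (dir j) f) (itvcc (switch j) s).

(** With [x] the supremum over piece [j], this is the distance, lessened by [c],
    between the extremal values of [f] on the pieces [j - 1] and [j]. *)
Definition swing (j : nat) (x : R) : R := if j is i.+1 then x + top i - c else 0.

Definition share (e : bool) (j : nat) (x : R) : R :=
  if dir j == e then swing j x else 0.

(** The value at [s] of [f_U] ([e = true]) or of [f_D] ([e = false]) when [s] lies
    in piece [j]. *)
Definition gain (e : bool) (j : nat) (s : R) : R :=
  \sum_(i < j) share e i (top i) + share e j (top_at j s).

Lemma dirS j : dir j.+1 = ~~ dir j.
Proof. by rewrite /dir /= addbN. Qed.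

Lemma shareD j x : share true j x + share false j x = swing j x.
Proof. by rewrite /share; case: (dir j); rewrite /= ?addr0 ?add0r. Qed.

Lemma gainD j s :
  gain true j s + gain false j s =
  \sum_(i < j) swing i (top i) + swing j (top_at j s).
Proof.
rewrite /gain addrACA -big_split /= shareD; congr (_ + _).
by apply: eq_bigr => i _; exact: shareD.
Qed.

Lemma le_switchS j : (switch j <= switch j.+1)%E.
Proof. exact: le_drop_time. Qed.

Lemma switch_homo i j : (i <= j)%N -> (switch i <= switch j)%E.
Proof.
move=> ij; rewrite -(subnK ij); elim: (j - i)%N => [|k IH]; first by rewrite add0n.
by rewrite addSn (le_trans IH) // le_switchS.
Qed.

Lemma ge_switch j : (a%:E <= switch j)%E.
Proof. exact: (switch_homo (leq0n j)). Qed.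

Hypotheses (c0 : 0 < c) (fab : cadlag a b f).

Let gbnd j := signed_has_ubound (dir j) fab.

Lemma piece_sub j : piece j `<=` `[a, b].
Proof. exact: itvco_sub. Qed.

Lemma piece_lt i j u v : (i < j)%N -> piece i u -> piece j v -> u < v.
Proof.
move=> ij [/andP[_ ui] _] [/andP[jv _] _]; rewrite -lte_fin.
by apply: (lt_le_trans ui); apply: le_trans jv; exact: switch_homo.
Qed.

Lemma itvcc_piece j u : piece j u -> itvcc (switch j) u `<=` piece j.
Proof.
move=> [/andP[_ uS] /andP[_ ub]] x [jx xu]; split.
  by rewrite jx (le_lt_trans _ uS) ?lee_fin.
by rewrite (le_trans xu ub) andbT -lee_fin (le_trans (ge_switch j)).
Qed.

Lemma itvcc_refl j u : piece j u -> itvcc (switch j) u u.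
Proof. by move=> [/andP[ju _] _]; split. Qed.

Lemma switch_attained j : (switch j.+1 <= b%:E)%E ->
  exists y, [/\ switch j.+1 = y%:E, (switch j < y%:E)%E, y <= b &
    c <= top j - signed (dir j) f y].
Proof.
move=> jb; have [y [Dy jy yb cy]] := drop_time_attained c0 (gbnd j)
  (signed_right_cont (e := dir j) fab) (ge_switch j) jb.
exists y; split => //; rewrite /top /piece.
by rewrite [switch j.+1]Dy.
Qed.

Lemma piece_nonempty j : (switch j.+1 <= b%:E)%E -> piece j !=set0.
Proof.
move=> /switch_attained[y [Dy jy yb _]].
have := ge_switch j; case E : (switch j) jy => [x||] // xy ax.
exists x; split; rewrite ?E ?Dy ?lexx //; move: xy ax; rewrite lte_fin lee_fin; lra.
Qed.

Lemma piece_pred_nonempty i j u : piece j u -> (i < j)%N -> piece i !=set0.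
Proof.
move=> [/andP[ju _] /andP[_ ub]] ij; apply: piece_nonempty.
by apply: (le_trans (switch_homo ij)); apply: (le_trans ju); rewrite lee_fin.
Qed.

Lemma le_top_at j u : piece j u -> signed (dir j) f u <= top_at j u.
Proof.
move=> ju; apply: (le_sup_on (gbnd j)); last exact: itvcc_refl.
by apply: subset_trans (piece_sub (j := j)); exact: itvcc_piece.
Qed.

Lemma top_at_lt j u : piece j u -> top_at j u - signed (dir j) f u < c.
Proof.
by move=> [/andP[ju uS] /andP[_ ub]]; exact: (lt_drop_time ju ub uS).
Qed.

Lemma top_at_homo j u v : piece j u -> piece j v -> u <= v -> top_at j u <= top_at j v.
Proof.
move=> ju jv uv; apply: sup_on_le; first by exists u; exact: itvcc_refl.
move=> x [jx xu]; apply: (le_sup_on (gbnd j)); last by split => //; lra.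
by apply: subset_trans (piece_sub (j := j)); exact: itvcc_piece.
Qed.

Lemma top_at_le_top j u : piece j u -> top_at j u <= top j.
Proof.
move=> ju; apply: sup_on_le; first by exists u; exact: itvcc_refl.
move=> x /(itvcc_piece ju) jx; exact: (le_sup_on (gbnd j) (piece_sub (j := j))).
Qed.

(** At the starting point [y] of the piece the preceding drop has just reached
    size [c]; after the change of sign this bounds the new supremum from below. *)
Lemma swing_top_at_ge0 j u : piece j u -> 0 <= swing j (top_at j u).
Proof.
case: j => // j ju; have [/andP[Su _] /andP[_ ub]] := ju.
have [|y [Dy jy yb cy]] := @switch_attained j.
  by rewrite (le_trans Su) // lee_fin.
have yu : y <= u by rewrite -lee_fin -Dy.
have : signed (dir j.+1) f y <= top_at j.+1 u.
  apply: (le_sup_on (gbnd j.+1)); last by split => //; rewrite Dy.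
  by apply: subset_trans (piece_sub (j := j.+1)); exact: itvcc_piece.
rewrite dirS signedN /=; lra.
Qed.

Lemma swing_homo j x y : x <= y -> swing j x <= swing j y.
Proof. by case: j => //= j xy; rewrite -!addrA lerD2r. Qed.

Lemma share_homo e j x y : x <= y -> share e j x <= share e j y.
Proof. by move=> xy; rewrite /share; case: ifP => // _; exact: swing_homo. Qed.

Lemma share_top_at_ge0 e j u : piece j u -> 0 <= share e j (top_at j u).
Proof. by move=> ju; rewrite /share; case: ifP => // _; exact: swing_top_at_ge0. Qed.

Lemma share_top_ge0 e j u : piece j u -> 0 <= share e j (top j).
Proof.
move=> ju; apply: le_trans (share_top_at_ge0 e ju) _.
by apply/share_homo/top_at_le_top.
Qed.

Lemma gain_ge0 e j u : piece j u -> 0 <= gain e j u.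
Proof.
move=> ju; apply: addr_ge0; last exact: share_top_at_ge0.
apply: sumr_ge0 => i _; have [v iv] := piece_pred_nonempty ju (ltn_ord i).
exact: share_top_ge0 iv.
Qed.

(** Within one piece the running supremum is nondecreasing; across a boundary the
    share of the current piece is between [0] and its final value. *)
Lemma gain_homo e i j u v : piece i u -> piece j v -> u <= v ->
  gain e i u <= gain e j v.
Proof.
move=> iu jv uv; have [ij|ji|ij] := ltngtP i j.
- have : gain e i u <= \sum_(k < i.+1) share e k (top k).
    by rewrite big_ord_recr /= lerD2l; apply/share_homo/top_at_le_top.
  move=> /le_trans; apply; rewrite /gain.
  apply: le_trans (_ : \sum_(k < j) share e k (top k) <= _); last first.
    by rewrite lerDl; exact: share_top_at_ge0.
  rewrite -!(big_mkord xpredT (fun k => share e k (top k))).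
  rewrite [leRHS](@big_cat_nat _ _ _ i.+1) //= lerDl.
  rewrite big_nat_cond; apply: sumr_ge0 => k /andP[/andP[_ kj] _].
  by have [w kw] := piece_pred_nonempty jv kj; exact: share_top_ge0 kw.
- by have := piece_lt ji jv iu; lra.
- by subst j; rewrite lerD2l; apply: share_homo; exact: top_at_homo.
Qed.

(** Otherwise the times form an increasing sequence; at its limit [L] the left
    limit [l] of [f] makes [f] oscillate by less than [c] on a whole piece close
    to [L], so that no drop of size [c] can end this piece. *)
Lemma piece_exists s : a < s <= b -> exists j, piece j s.
Proof.
move=> sab; apply: contrapT => /forallNP none.
have les j : (switch j <= s%:E)%E.
  elim: j => [|j IH]; first by rewrite lee_fin; lra.
  rewrite leNgt; apply/negP => sj; apply: (none j); split; last lra.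
  by rewrite IH.
have leb j : (switch j <= b%:E)%E by rewrite (le_trans (les j)) // lee_fin; lra.
have fin j : switch j = (fine (switch j))%:E.
  by have := ge_switch j; have := les j; case: (switch j).
pose y j := fine (switch j).
have yS j : y j < y j.+1.
  have [z [Dz jz _ _]] := switch_attained (leb j.+1).
  by rewrite -lte_fin /y -!fin Dz.
have ys j : y j <= s by rewrite -lee_fin -fin.
have hs : has_sup (range y).
  by split; [exists (y 0%N), 0%N|exists s => _ [j _ <-]].
pose L := sup (range y).
have yL j : y j < L.
  by apply: (lt_le_trans (yS j)); apply: ub_le_sup; [exact: hs.2|exists j.+1].
have aL : a < L by have := yL 0%N.
have Lb : L <= b.
  apply: ge_sup => [|_ [j _ <-]]; first exact: hs.1.
  by have := ys j; lra.
have c20 : 0 < c / 2 by rewrite divr_gt0.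
have /cvg_ex[l /cvgrPdist_lt /(_ _ c20)] : cvg (f x @[x --> L^'-]) by apply: fab.2; lra.
case=> d /= d0 Hd.
have [_ [j _ <-] jL] := sup_adherent d0 hs.
have close x : y j <= x -> x < L -> `|l - f x| < c / 2.
  by move=> jx xL; apply: Hd; rewrite /= ?ltr_distl; move: jL; rewrite -/L; lra.
have [z [Dz jz zb]] := switch_attained (leb j.+1).
have zy : z = y j.+1 by rewrite /y Dz.
have zL : z < L by rewrite zy.
have yz : y j <= z by rewrite zy ltW.
have : top j <= signed (dir j) f z + `|l - f z| + c / 2.
  apply: sup_on_le => [|x [/andP[jx xS] _]]; first exact: piece_nonempty.
  move: jx xS; rewrite Dz fin lee_fin lte_fin => jx xz.
  have := close x jx (lt_trans xz zL).
  have := ler_norm (l - f z); have := ler_norm (- (l - f z)); rewrite normrN.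
  have := ler_norm (l - f x); have := ler_norm (- (l - f x)); rewrite normrN.
  by rewrite /signed; case: (dir j); lra.
by have := close z yz zL; lra.
Qed.

(** The last point is kept in a subset [A] of the last piece, so that the same
    statement serves both for complete pieces, in the induction, and for the
    piece truncated at the final time.  A chain may consist of one point
    ([n = 0]), which is all that piece [0] requires. *)
Lemma chain_in_pieces j A e : A `<=` piece j -> A !=set0 -> 0 < e ->
  exists n (t : nat -> R), [/\ (j <= n)%N, a <= t 0%N,
    (forall i, (i < n)%N -> t i < t i.+1), A (t n) /\
    sup_on (signed (dir j) f) A - e < signed (dir j) f (t n) &
    \sum_(i < j) swing i (top i) + swing j (sup_on (signed (dir j) f) A) - e <=
    \sum_(1 <= i < n.+1) Num.max (`|f (t i) - f (t i.-1)| - c) 0].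
Proof.
elim: j A e => [|j IH] A e Aj A0 e0.
  have [u Au eu] := sup_on_adherent (gbnd 0) (subset_trans Aj (piece_sub (j := 0))) A0 e0.
  exists 0%N, (fun=> u); split => //; first by have [_ /andP[]] := Aj _ Au.
  by rewrite big_ord0 big_nil /=; lra.
(* three errors add up: the sum so far and the two ends of the new step *)
have e30 : 0 < e / 3 by lra.
have j0 : piece j !=set0.
  by have [u /Aj ju] := A0; exact: (piece_pred_nonempty ju).
have [n [t [jn at0 tS [tn tne] tsum]]] := IH _ _ (@subset_refl _ _) j0 e30.
have [v Av ev] :=
  sup_on_adherent (gbnd j.+1) (subset_trans Aj (piece_sub (j := j.+1))) A0 e30.
have tnv : t n < v by apply: (piece_lt (ltnSn j) tn); exact: Aj.
exists n.+1, (fun i => if (i <= n)%N then t i else v); split => //=.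
- move=> i; rewrite ltnS => iN; rewrite iN.
  by case: ltnP => [|ni]; [exact: tS|have -> : i = n by lia].
- by rewrite ltnn; split => //; lra.
rewrite big_nat_recr //= ltnn leqnn.
under eq_big_nat => i /andP[i1 iN].
  rewrite (_ : (i <= n)%N) // (_ : (i.-1 <= n)%N); last by lia.
  over.
rewrite big_ord_recr /=; move: tsum; rewrite -/(top j) => tsum.
have : signed (dir j.+1) f v - signed (dir j.+1) f (t n) - c <=
    Num.max (`|f v - f (t n)| - c) 0.
  rewrite le_max lerD2r /signed; apply/orP; left; case: (dir j.+1).
    exact: ler_norm.
  by rewrite -normrN (le_trans _ (ler_norm _)) // opprB; lra.
move: ev tne; rewrite -/(top j) dirS !signedN => ev tne ?.
by lra.
Qed.

(** * The band around the difference of the gains *)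

(** The process starts with the move that [f] makes first. *)
Hypothesis first_switch : (switch 1 <= drop_time (signed (dir 1) f) b c a%:E)%E.

(** During piece [0] there is neither a rise nor a drop of size [c]; which of the
    two is used depends on the order of [u] and [v]. *)
Lemma piece0_osc u v : piece 0 u -> piece 0 v ->
  signed (dir 0) f u - signed (dir 0) f v <= c.
Proof.
move=> pu pv; have [uv|vu] := leP u v.
  have : signed (dir 0) f u <= top_at 0 v.
    by apply: le_trans (le_top_at pu) (top_at_homo _ _ _).
  by have := top_at_lt pv; lra.
have [/andP[au uS] /andP[_ ub]] := pu.
have := lt_drop_time au ub (lt_le_trans uS first_switch).
have : signed (dir 1) f v <= sup_on (signed (dir 1) f) (itvcc a%:E u).
  apply: (le_sup_on (gbnd 1) (itvcc_sub _ ub)) => //; split; last exact: ltW.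
  by have [/andP[]] := pv.
rewrite dirS !signedN; lra.
Qed.

Let gap j s := gain (dir 1) j s - gain (dir 0) j s.

(** The terms of the two gains come with alternating signs, so that
    [top i + top (i - 1) - c] telescopes. *)
Lemma gapE j s : gap j s =
  if j is i.+1 then
    if odd i then top 0 - top_at j s else top 0 + top_at j s - c
  else 0.
Proof.
have d0 i : (dir i == dir 0) = ~~ odd i by rewrite /dir; case: beta (odd i) => [] [].
have d1 i : (dir i == dir 1) = odd i by rewrite /dir; case: beta (odd i) => [] [].
have H i : \sum_(k < i.+1) share (dir 1) k (top k) - \sum_(k < i.+1) share (dir 0) k (top k)
    = if odd i then top i + top 0 - c else top 0 - top i.
  elim: i => [|i IH]; first by rewrite !big_ord1 /share !d0 !d1 /= !subrr.
  rewrite big_ord_recr [X in _ - X]big_ord_recr /= opprD addrACA IH.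
  by rewrite /share d0 d1 /=; case: (odd i) => /=; lra.
rewrite /gap /gain; case: j => [|i].
  by rewrite !big_ord0 /share d0 d1 /= !addr0 subrr.
rewrite opprD addrACA H /share d0 d1 /=; case: (odd i) => /=; lra.
Qed.

(** For [0 < j], adding [top 0] to the middle term gives, by [gapE], the distance of
    [signed (dir j) f s] to its running supremum ([j] even) or [c] minus that
    distance ([j] odd); the distance is less than [c] before the next switch.
    On piece [0] the band is that of [piece0_osc]. *)
Lemma gap_band j s : piece j s ->
  - top 0 <= signed (dir 1) f s - gap j s <= c - top 0.
Proof.
move=> js; rewrite gapE; case: j js => [|i] js.
  have : signed (dir 0) f s <= top 0.
    exact: (le_sup_on (gbnd 0) (piece_sub (j := 0))).
  have : top 0 <= signed (dir 0) f s + c.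
    apply: sup_on_le; first by exists s.
    by move=> u pu; have := piece0_osc pu js; lra.
  by rewrite dirS signedN; lra.
have := le_top_at js; have := top_at_lt js.
have -> : dir i.+1 = if odd i then ~~ dir 1 else dir 1.
  by rewrite /dir /=; case: beta (odd i) => [] [].
by case: (odd i); rewrite ?signedN; lra.
Qed.

(** By [gap_band] the increments of [signed e f] exceed those of the difference of
    the gains by at most [c], and the gain that is subtracted is nondecreasing. *)
Lemma increment_le_gain e i j u v : piece i u -> piece j v -> u <= v ->
  signed e f v - signed e f u - c <= gain e j v - gain e i u.
Proof.
move=> iu jv uv.
have := gap_band iu; have := gap_band jv; rewrite /gap.
have := gain_homo (dir 0) iu jv uv; have := gain_homo (dir 1) iu jv uv.
have : e = dir 1 \/ e = dir 0 by rewrite /dir; case: beta e => [] []; auto.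
by case=> ->; rewrite 1?dirS ?signedN; lra.
Qed.

End alternation.
End cadlag_functions.

(** * From increment bounds to truncated variations *)

Section variation_criterion.
Set Implicit Arguments.
Unset Strict Implicit.
Context {R : realType}.
Variables (f : R -> R) (a s c : R).

Lemma subdivision_itv n (t : nat -> R) i :
  subdivision a s n t -> (i <= n)%N -> a <= t i <= s.
Proof.
move=> [_ at0 tS tns] iN.
have tle j k : (j <= k)%N -> (k <= n)%N -> t j <= t k.
  move=> jk; rewrite -(subnK jk); elim: (k - j)%N => [|m IH] kn; first by rewrite add0n.
  by rewrite (le_trans (IH _)) ?addSn ?ltW ?tS //; lia.
by rewrite (le_trans at0) ?(le_trans _ tns) ?tle.
Qed.

Lemma sum_le_increment (H : R -> R) (F : R -> R -> R) n (t : nat -> R) :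
  0 <= H a -> (forall u v, a <= u -> u <= v -> v <= s -> H u <= H v) ->
  (forall u v, a <= u -> u <= v -> v <= s -> F v u <= H v - H u) ->
  subdivision a s n t -> \sum_(1 <= i < n.+1) F (t i) (t i.-1) <= H s.
Proof.
move=> Ha Hhomo FH sub; have [_ at0 tS tns] := sub.
have tin i := subdivision_itv (i := i) sub.
have -> : \sum_(1 <= i < n.+1) F (t i) (t i.-1) = \sum_(0 <= i < n) F (t i.+1) (t i).
  by rewrite big_add1.
apply: le_trans (_ : \sum_(0 <= i < n) (H (t i.+1) - H (t i)) <= _).
  apply: ler_sum_nat => i /andP[_ iN]; apply: FH; first by have /andP[] := tin i (ltnW iN).
    by rewrite ltW ?tS.
  by have /andP[] := tin i.+1 iN.
rewrite (telescope_sumr (fun i => H (t i))) //.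
have /andP[h1 h2] := tin n (leqnn n); have /andP[h3 h4] := tin 0%N isT.
have := Hhomo (t n) s h1 h2 (lexx _); have := Hhomo a (t 0%N) (lexx _) h3 h4; lra.
Qed.

Variable G : bool -> R -> R.
Hypotheses (G_ge0 : forall e, 0 <= G e a).
Hypothesis G_homo : forall e u v, a <= u -> u <= v -> v <= s -> G e u <= G e v.
Hypothesis G_incr : forall e u v, a <= u -> u <= v -> v <= s ->
  signed e f v - signed e f u - c <= G e v - G e u.

Let inc (e : bool) (v u : R) := Num.max (signed e f v - signed e f u - c) 0.

Let inc_le e u v : a <= u -> u <= v -> v <= s -> inc e v u <= G e v - G e u.
Proof. by move=> au uv vs; rewrite ge_max G_incr // subr_ge0 G_homo. Qed.

Lemma tv_term_le u v :
  Num.max (`|f v - f u| - c) 0 <= inc true v u + inc false v u.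
Proof.
rewrite /inc /=.
set y := Num.max (_ - _ - c) 0; set z := Num.max (_ - _ - c) 0.
have y0 : 0 <= y by rewrite le_max lexx orbT.
have z0 : 0 <= z by rewrite le_max lexx orbT.
have yE : f v - f u - c <= y by rewrite le_max lexx.
have zE : - f v - - f u - c <= z by rewrite le_max lexx.
rewrite ge_max addr_ge0 // andbT; have [h|h] := ger0P (f v - f u); lra.
Qed.

(** The bounds on increments give the three upper bounds.  If the [TV] sum of a
    subdivision is within [e] of [G true s + G false s], then its [UTV] sum is
    within [e] of [G true s], because its [DTV] sum is at most [G false s]; and
    the same with the roles exchanged. *)
Lemma variations_eq :
  (forall e, 0 < e -> exists n t, subdivision a s n t /\ G true s + G false s - e <=
    \sum_(1 <= i < n.+1) Num.max (`|f (t i) - f (t i.-1)| - c) 0) ->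
  [/\ UTV f c a s = (G true s)%:E, DTV f c a s = (G false s)%:E
    & TV f c a s = (G true s + G false s)%:E].
Proof.
move=> approx.
have le_inc e n t : subdivision a s n t ->
    \sum_(1 <= i < n.+1) inc e (t i) (t i.-1) <= G e s.
  exact: (sum_le_increment (H := G e) (F := inc e) (G_ge0 e) (G_homo e) (@inc_le e)).
have le_tv n (t : nat -> R) :
    \sum_(1 <= i < n.+1) Num.max (`|f (t i) - f (t i.-1)| - c) 0 <=
    \sum_(1 <= i < n.+1) inc true (t i) (t i.-1) +
    \sum_(1 <= i < n.+1) inc false (t i) (t i.-1).
  by rewrite -big_split /=; apply: ler_sum => i _; exact: tv_term_le.
have incN u v : inc false v u = Num.max (f u - f v - c) 0.
  by rewrite /inc /= opprK [- f v + _]addrC.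
have DTVE n (t : nat -> R) : \sum_(1 <= i < n.+1) Num.max (f (t i.-1) - f (t i) - c) 0
    = \sum_(1 <= i < n.+1) inc false (t i) (t i.-1).
  by apply: eq_bigr => i _; rewrite incN.
split; apply/eqP; rewrite eq_le; apply/andP; split.
- by apply: ge_ereal_sup => _ [n [t [sub ->]]]; rewrite lee_fin; exact: (le_inc true).
- apply/lee_addgt0Pr => e e0; rewrite -leeBlDr //.
  have [n [t [sub tsum]]] := approx e e0.
  apply: le_ereal_sup_tmp; eexists; first by exists n, t.
  rewrite -EFinB lee_fin; have := le_tv n t; have := le_inc false n t sub.
  by rewrite {2}/inc /= => ? ?; lra.
- apply: ge_ereal_sup => _ [n [t [sub ->]]]; rewrite lee_fin DTVE; exact: le_inc.
- apply/lee_addgt0Pr => e e0; rewrite -leeBlDr //.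
  have [n [t [sub tsum]]] := approx e e0.
  apply: le_ereal_sup_tmp; eexists; first by exists n, t.
  rewrite -EFinB lee_fin DTVE; have := le_tv n t; have := le_inc true n t sub.
  by move=> ? ?; lra.
- apply: ge_ereal_sup => _ [n [t [sub ->]]]; rewrite lee_fin.
  by apply: le_trans (le_tv n t) (lerD (le_inc _ _ _ sub) (le_inc _ _ _ sub)).
- apply/lee_addgt0Pr => e e0; rewrite -leeBlDr //.
  have [n [t [sub tsum]]] := approx e e0.
  apply: le_ereal_sup_tmp; eexists; first by exists n, t.
  by rewrite -EFinB lee_fin.
Qed.

End variation_criterion.

Section alternation_variation.
Set Implicit Arguments.
Unset Strict Implicit.
Context {R : realType}.
Variables (a b c : R) (f : R -> R) (beta : bool).
Hypotheses (c0 : 0 < c) (fab : cadlag a b f).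
Hypothesis first_switch : 
  (switch a b c f beta 1 <= drop_time (signed (dir beta 1) f) b c a%:E)%E.

Lemma piece0_start : a < b -> piece a b c f beta 0 a.
Proof.
move=> ab; split; last by lra.
rewrite /= lexx /=; rewrite ltNge; apply/negP => le.
have [|y [Dy ay _ _]] := @switch_attained R a b c f beta c0 fab 0.
  by apply: le_trans le _; rewrite lee_fin ltW.
by move: le; rewrite leNgt [X in (_ < X)%E]Dy ay.
Qed.

Lemma alternation_variations j s : a < s <= b -> piece a b c f beta j s ->
  [/\ UTV f c a s = (gain a b c f beta true j s)%:E,
      DTV f c a s = (gain a b c f beta false j s)%:E
    & TV f c a s =
      (gain a b c f beta true j s + gain a b c f beta false j s)%:E].
Proof.
move=> sab js.
have ab : a < b by lra.
pose idx u := xget 0%N [set i | piece a b c f beta i u].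
have idxP u : a <= u <= s -> piece a b c f beta (idx u) u.
  move=> us; apply: (xgetPex 0%N (P := [set i | piece a b c f beta i u])).
  have [au|ua] := ltP a u; last first.
    by have -> : u = a; [lra|exists 0%N; exact: piece0_start].
  by apply: piece_exists => //; lra.
have idxs : idx s = j.
  have pi : piece a b c f beta (idx s) s by apply: idxP; lra.
  by have [ij|ji|//] := ltngtP (idx s) j;
    [have := piece_lt ij pi js|have := piece_lt ji js pi]; rewrite ltxx.
rewrite -idxs.
apply: (@variations_eq R f a s c (fun e u => gain a b c f beta e (idx u) u)).
- by move=> e; apply: gain_ge0 => //; apply: idxP; lra.
- by move=> e u v au uv vs; apply: gain_homo => //; apply: idxP; lra.
- by move=> e u v au uv vs; apply: increment_le_gain => //; apply: idxP; lra.
move=> e e0; rewrite gainD idxs.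
have As := itvcc_piece js.
have [|n [t [jn at0 tS [[_ tns] _] tsum]]] := chain_in_pieces c0 fab As _ e0.
  by exists s; exact: itvcc_refl.
(* a chain of one point is not a subdivision; it occurs for [j = 0] only, where
   the gains vanish and any subdivision will do *)
case: n => [|n] in jn tS tns tsum *; last by exists n.+1, t; split => //; split.
move: jn tsum; rewrite leqn0 => /eqP ->.
rewrite big_ord0 /= add0r => _; exists 1%N, (fun i => if i is 0%N then a else s).
split; last by rewrite big_nat1 /= le_max; apply/orP; right; lra.
by split => //=; case=> // _; lra.
Qed.

End alternation_variation.

(** * Identification with the explicit formulas *)

Section explicit_formulas.
Set Implicit Arguments.
Unset Strict Implicit.
Context {R : realType}.
Variables (a b c : R) (f : R -> R).
Hypotheses (c0 : 0 < c) (fab : cadlag a b f).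

Lemma rise_timeE (T : \bar R) : rise_time f b c T = drop_time (signed false f) b c T.
Proof.
rewrite /rise_time /drop_time; congr (ereal_inf (EFin @` _)).
by apply/seteqP; split => u [Tu] /=; rewrite inf_onE !opprK addrC; split.
Qed.

Lemma next_riseE (T : \bar R) : next_rise f b c T = drop_time (signed false f) b c T.
Proof. by rewrite -(next_dropE _ _ c0) /next_rise /next_drop rise_timeE. Qed.

Lemma next_drop_signed (T : \bar R) : next_drop f b c T = drop_time (signed true f) b c T.
Proof. exact: next_dropE. Qed.

(** The term of index [0] remains when the even indices are selected; [swing]
    vanishes there. *)
Lemma sum_alternate (F : nat -> R) k (o : bool) :
  \sum_(i < k.*2.+1) (if odd i == o then F i else 0) =
  if o then \sum_(i < k) F i.*2.+1 else F 0%N + \sum_(i < k) F i.*2.+2.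
Proof.
elim: k => [|k IH].
  by case: o; rewrite !big_ord1 big_ord0 /= ?addr0.
rewrite doubleS 2!big_ord_recr IH /= odd_double.
by case: o {IH}; rewrite /= !big_ord_recr /= ?addr0 // addrA.
Qed.

Lemma gain_odd beta e k s : gain a b c f beta e k.*2.+1 s =
  \sum_(i < k) swing a b c f beta (if beta (+) e then i.*2.+1 else i.*2.+2)
     (top a b c f beta (if beta (+) e then i.*2.+1 else i.*2.+2)) +
  (if beta (+) e then swing a b c f beta k.*2.+1 (top_at a b c f beta k.*2.+1 s) else 0).
Proof.
have de i : (dir beta i == e) = (odd i == beta (+) e).
  by rewrite /dir; case: beta e (odd i) => [] [] [].
rewrite /gain /share; under eq_bigr do rewrite de.
rewrite (sum_alternate (fun i => swing a b c f beta i (top a b c f beta i))) de /=.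
by rewrite odd_double; case: (beta (+) e); rewrite /= ?add0r.
Qed.

Lemma gain_even beta e k s : gain a b c f beta e k.*2.+2 s =
  \sum_(i < k + (beta (+) e)) swing a b c f beta (if beta (+) e then i.*2.+1 else i.*2.+2)
     (top a b c f beta (if beta (+) e then i.*2.+1 else i.*2.+2)) +
  (if beta (+) e then 0 else swing a b c f beta k.*2.+2 (top_at a b c f beta k.*2.+2 s)).
Proof.
have de i : (dir beta i == e) = (odd i == beta (+) e).
  by rewrite /dir; case: beta e (odd i) => [] [] [].
rewrite /gain /share; under eq_bigr do rewrite de.
rewrite big_ord_recr /= de /=.
rewrite (sum_alternate (fun i => swing a b c f beta i (top a b c f beta i))) /=.
rewrite odd_double; case: (beta (+) e) => /=.
  by rewrite addn1 big_ord_recr.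
by rewrite addn0 add0r addr0.
Qed.

Lemma gain0 beta e s : gain a b c f beta e 0 s = 0.
Proof. by rewrite /gain big_ord0 /share; case: ifP; rewrite addr0. Qed.

Lemma dir_even beta k : dir beta k.*2 = beta.
Proof. by rewrite /dir odd_double addbF. Qed.

Lemma dir_odd beta k : dir beta k.*2.+1 = ~~ beta.
Proof. by rewrite dirS dir_even. Qed.

Lemma T_UE k : T_U f a b c k = switch a b c f false k.*2.+1.
Proof.
elim: k => [|k IH]; first exact: rise_timeE.
by rewrite /= next_riseE next_drop_signed IH /dir /= odd_double.
Qed.

Lemma T_DE k : T_D f a b c k = switch a b c f false k.*2.+2.
Proof. by rewrite /T_D next_drop_signed T_UE /= /dir /= odd_double. Qed.

Lemma T_D_predE k : T_D_pred f a b c k = switch a b c f false k.*2.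
Proof. by case: k => // k; exact: T_DE. Qed.

Lemma m_E k : m_ f a b c k = - top a b c f false k.*2.
Proof. by rewrite /m_ inf_onE T_D_predE T_UE /top dir_even. Qed.

Lemma M_E k : M_ f a b c k = top a b c f false k.*2.+1.
Proof. by rewrite /M_ T_UE T_DE /top dir_odd. Qed.

Lemma m_atE k s : m_at f a b c k s = - top_at a b c f false k.*2 s.
Proof. by rewrite /m_at inf_onE T_D_predE /top_at dir_even. Qed.

Lemma M_atE k s : M_at f a b c k s = top_at a b c f false k.*2.+1 s.
Proof. by rewrite /M_at T_UE /top_at dir_odd. Qed.

Lemma S_DE k : S_D f a b c k = switch a b c f true k.*2.+1.
Proof.
elim: k => [|k IH]; first by [].
by rewrite /= next_riseE next_drop_signed IH /dir /= odd_double.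
Qed.

Lemma S_UE k : S_U f a b c k = switch a b c f true k.*2.+2.
Proof. by rewrite /S_U next_riseE S_DE /= /dir /= odd_double. Qed.

Lemma S_U_predE k : S_U_pred f a b c k = switch a b c f true k.*2.
Proof. by case: k => // k; exact: S_UE. Qed.

Lemma N_E k : N_ f a b c k = top a b c f true k.*2.
Proof. by rewrite /N_ S_U_predE S_DE /top dir_even. Qed.

Lemma n_E k : n_ f a b c k = - top a b c f true k.*2.+1.
Proof. by rewrite /n_ inf_onE S_DE S_UE /top dir_odd. Qed.

Lemma N_atE k s : N_at f a b c k s = top_at a b c f true k.*2 s.
Proof. by rewrite /N_at S_U_predE /top_at dir_even. Qed.

Lemma n_atE k s : n_at f a b c k s = - top_at a b c f true k.*2.+1 s.
Proof. by rewrite /n_at inf_onE S_DE /top_at dir_odd. Qed.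

(** Piece [2 k + 1] is [[T_U k; T_D k)] and piece [2 k + 2] is
    [[T_D k; T_U (k + 1))]. *)
Lemma rise_gain s : a < s <= b -> exists2 j, piece a b c f false j s &
  rise_f_U f a b c s = gain a b c f false true j s /\
  rise_f_D f a b c s = gain a b c f false false j s.
Proof.
move=> sab; have [j js] := piece_exists false c0 fab sab.
rewrite /rise_f_U /rise_f_D.
have [sT|Ts] := ltP s%:E (T_U f a b c 0).
  exists 0%N; last by rewrite !gain0.
  by rewrite T_UE in sT; split; [rewrite [X in _ && X]sT andbT lee_fin|]; lra.
have : exists k, [set k | (T_U f a b c k <= s%:E < T_D f a b c k)%E \/
    (T_D f a b c k <= s%:E < T_U f a b c k.+1)%E] k.
  have [js' _] := js; case: j js js' => [|j] js js'.
    by move: js' Ts; rewrite T_UE => /andP[_ h]; rewrite leNgt h.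
  exists j./2; rewrite /mkset !T_UE !T_DE doubleS; move: js'.
  have := odd_double_half j; case: (odd j) => /= <-; [right|left]; move: js';
    by rewrite ?add0n ?add1n /= ?doubleK ?uphalf_double.
move=> /(xgetPex 0%N); rewrite -/(T_index f a b c s).
set k := T_index f a b c s => kP.
have [sD|Ds] := ltP s%:E (T_D f a b c k).
  have Us : (T_U f a b c k <= s%:E)%E.
    case: kP => /andP[] // Ds _; by move: sD; rewrite ltNge Ds.
  exists k.*2.+1.
    by split; [rewrite -T_UE -T_DE Us|lra].
  rewrite !gain_odd /= ?addr0; split; last first.
    by apply: eq_bigr => i _; rewrite M_E m_E /=; lra.
  rewrite M_atE m_E opprK; congr (_ + _).
  by apply: eq_bigr => i _; rewrite M_E m_E opprK.
have sU : (s%:E < T_U f a b c k.+1)%E.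
  case: kP => /andP[] // _ sD; by move: sD; rewrite ltNge Ds.
exists k.*2.+2.
  by split; [rewrite -doubleS -T_UE doubleS -T_DE Ds|lra].
rewrite !gain_even /= ?addr0 ?addn0 ?addn1; split.
  by apply: eq_bigr => i _; rewrite M_E m_E opprK.
rewrite M_E m_atE opprK; congr (_ + _); last by rewrite doubleS; lra.
by apply: eq_bigr => i _; rewrite M_E m_E opprK doubleS; lra.
Qed.

(** Piece [2 k + 1] is [[S_D k; S_U k)] and piece [2 k + 2] is
    [[S_U k; S_D (k + 1))]. *)
Lemma drop_gain s : a < s <= b -> exists2 j, piece a b c f true j s &
  drop_f_U f a b c s = gain a b c f true true j s /\
  drop_f_D f a b c s = gain a b c f true false j s.
Proof.
move=> sab; have [j js] := piece_exists true c0 fab sab.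
rewrite /drop_f_U /drop_f_D.
have [sS|Ss] := ltP s%:E (S_D f a b c 0).
  exists 0%N; last by rewrite !gain0.
  by rewrite S_DE in sS; split; [rewrite [X in _ && X]sS andbT lee_fin|]; lra.
have : exists k, [set k | (S_D f a b c k <= s%:E < S_U f a b c k)%E \/
    (S_U f a b c k <= s%:E < S_D f a b c k.+1)%E] k.
  have [js' _] := js; case: j js js' => [|j] js js'.
    by move: js' Ss; rewrite S_DE => /andP[_ h]; rewrite leNgt h.
  exists j./2; rewrite /mkset !S_DE !S_UE doubleS; move: js'.
  have := odd_double_half j; case: (odd j) => /= <-; [right|left]; move: js';
    by rewrite ?add0n ?add1n /= ?doubleK ?uphalf_double.
move=> /(xgetPex 0%N); rewrite -/(S_index f a b c s).
set k := S_index f a b c s => kP.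
have [sU|Us] := ltP s%:E (S_U f a b c k).
  have Ds : (S_D f a b c k <= s%:E)%E.
    case: kP => /andP[] // Us _; by move: sU; rewrite ltNge Us.
  exists k.*2.+1.
    by split; [rewrite -S_DE -S_UE Ds|lra].
  rewrite !gain_odd /= ?addr0; split.
    by apply: eq_bigr => i _; rewrite N_E n_E opprK doubleS.
  rewrite N_E n_atE; congr (_ + _); last by lra.
  by apply: eq_bigr => i _; rewrite N_E n_E; lra.
have sD : (s%:E < S_D f a b c k.+1)%E.
  case: kP => /andP[] // _ sU; by move: sU; rewrite ltNge Us.
exists k.*2.+2.
  by split; [rewrite -doubleS -S_DE doubleS -S_UE Us|lra].
rewrite !gain_even /= ?addr0 ?addn0 ?addn1; split; last first.
  by apply: eq_bigr => i _; rewrite N_E n_E; lra.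
rewrite N_atE n_E opprK doubleS; congr (_ + _).
by apply: eq_bigr => i _; rewrite N_E n_E opprK doubleS.
Qed.

End explicit_formulas.

Theorem theorem2p3 (R : realType) (a b c : R) (f : R -> R)
    (hab : a < b) (hc : 0 < c) (hf : cadlag a b f)
    (s : R) (hs : a < s <= b) :
  [/\ UTV f c a s = (f_U f a b c s)%:E,
      DTV f c a s = (f_D f a b c s)%:E
    & TV f c a s = (f_U f a b c s + f_D f a b c s)%:E].
Proof.
rewrite /f_U /f_D; case: ifP => [rd|/negbT].
  have [j js [-> ->]] := rise_gain hc hf hs.
  by apply: alternation_variations => //; rewrite -(T_UE _ _ _ hc 0).
rewrite -ltNge => /ltW dr.
have [j js [-> ->]] := drop_gain hc hf hs.
by apply: alternation_variations => //; rewrite -[leRHS]rise_timeE.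
Qed.
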